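(* Let $x_*$ be a locally optimal solution of the problem \[ (\mathcal{P}) \quad \text{minimize } f_0(x) = g_0(x) - h_0(x) \quad \text{subject to } F(x) = G(x) - H(x) \preceq_K 0, \quad x \in Q, \] and let the mapping $H$ be Fréchet differentiable at $x_*$. Then for any $v \in \partial h_0(x_* )$ the point $x_*$ is a globally optimal solution of the following convex programming problem: \[ \text{minimize } g_0(x) - h_0(x_* ) - \langle v, x - x_* \rangle \quad \text{subject to } G(x) - H(x_* ) - D H(x_* )(x - x_* ) \preceq_K 0, \quad x \in Q, \] where $D H(x_* )$ is the Fréchet derivative of $H$ at $x_*$.
   Context: $g_0, h_0 \colon \mathbb{R}^d \to \mathbb{R}$ are real-valued closed convex functions; $\partial h_0$ is the subdifferential in the sense of convex analysis. $Y$ is a real Banach space and $K \subset Y$ is a proper cone, meaning a closed convex cone with $K \cap (-K) = \{0\}$; $x \preceq_K y$ iff $y - x \in K$. The maps $G, H \colon \mathbb{R}^d \to Y$ are $K$-convex: $G(\alpha x_1 + (1-\alpha)x_2) \preceq_K \alpha G(x_1) + (1-\alpha) G(x_2)$ for all $\alpha \in [0,1]$, $x_1, x_2 \in \mathbb{R}^d$, and similarly for $H$. $Q \subseteq \mathbb{R}^d$ is a closed convex set. *)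

(* Defs.v *)
From HB Require Import structures.
From mathcomp Require Import all_boot all_order all_algebra.
From mathcomp Require Import all_classical all_reals all_analysis.

Set Implicit Arguments.
Unset Strict Implicit.
Unset Printing Implicit Defensive.

Import Order.TTheory GRing.Theory Num.Theory.
Import numFieldNormedType.Exports.

Local Open Scope classical_set_scope.
Local Open Scope ring_scope.

Definition dotv (R : realType) (d : nat) (u v : 'rV[R]_d) : R :=
  \sum_(i < d) u 0 i * v 0 i.

(* A closed function is one whose epigraph is closed. *)
Definition closed_function (R : realType) (d : nat) (f : 'rV[R]_d -> R) : Prop :=
  closed [set p : 'rV[R]_d * R | f p.1 <= p.2].

Definition subdifferential (R : realType) (d : nat) (f : 'rV[R]_d -> R)
    (x : 'rV[R]_d) : set 'rV[R]_d :=
  [set v | forall y : 'rV[R]_d, f y - f x >= dotv v (y - x)].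

Definition is_cone (R : realType) (Y : lmodType R) (K : set Y) : Prop :=
  forall (t : R) (y : Y), 0 <= t -> K y -> K (t *: y).

(* No interior point is required: "proper" means closed, convex and pointed. *)
Definition proper_cone (R : realType) (Y : normedModType R) (K : set Y) : Prop :=
  [/\ closed K, convex_set K, is_cone K &
      K `&` [set - y | y in K] = [set 0]].

Definition cone_le (R : realType) (Y : lmodType R) (K : set Y) (x y : Y) : Prop :=
  K (y - x).

Definition cone_convex (R : realType) (d : nat) (Y : lmodType R) (K : set Y)
    (G : 'rV[R]_d -> Y) : Prop :=
  forall (a : R) (x1 x2 : 'rV[R]_d), 0 <= a <= 1 ->
    cone_le K (G (a *: x1 + (1 - a) *: x2)) (a *: G x1 + (1 - a) *: G x2).

Definition locally_optimal (R : realType) (d : nat) (f : 'rV[R]_d -> R)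
    (S : set 'rV[R]_d) (x : 'rV[R]_d) : Prop :=
  S x /\ \forall y \near x, S y -> f x <= f y.

Definition globally_optimal (R : realType) (d : nat) (f : 'rV[R]_d -> R)
    (S : set 'rV[R]_d) (x : 'rV[R]_d) : Prop :=
  S x /\ forall y, S y -> f x <= f y.

(* Main.v *)
(** The gradient inequality [H x_* + DH(x_* )(x - x_* ) <= H x] for [K]-convex
    maps, obtained by letting the slope of [H] along the segment [[x_*, x]] tend
    to its one-sided limit in the closed set [K], shows that points of the
    linearized problem are feasible for the original one, and the subgradient
    inequality for [h0] that its objective majorizes the original one, with
    equality at [x_*]. If [y] is feasible for the convex problem, the points
    [t y + (1 - t) x_*] with small [t > 0] are therefore feasible and no better
    than [x_*], and convexity of [g0] transfers this to [y]. *)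
Require Import Defs.
From HB Require Import structures.
From mathcomp Require Import all_boot all_order all_algebra.
From mathcomp Require Import all_classical all_reals all_analysis.
From mathcomp Require Import ring lra.

Set Implicit Arguments.
Unset Strict Implicit.
Unset Printing Implicit Defensive.

Import Order.TTheory GRing.Theory Num.Theory.
Import numFieldNormedType.Exports.

Local Open Scope classical_set_scope.
Local Open Scope ring_scope.

(** The sum is twice the midpoint: convexity puts the midpoint in [K], and the cone property
    rescales it. *)
Lemma convex_cone_add (R : realType) (Y : lmodType R) (K : set Y) (x y : Y) :
  convex_set K -> is_cone K -> K x -> K y -> K (x + y).
Proof.
move=> cK sK Kx Ky.
have h0 : 0 <= 2^-1 :> R by rewrite invr_ge0.
have h1 : 2^-1 <= 1 :> R by rewrite invf_le1// ler1n.
have : K (2^-1 *: x + (1 - 2^-1) *: y).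
  exact: set_mem (cK x y (Itv01 h0 h1) (mem_set Kx) (mem_set Ky)).
move=> /(sK 2 _ (ler0n _ _)).
rewrite scalerDr !scalerA mulrBr mulr1 mulfV// scale1r.
by rewrite (_ : 2 - 1 = 1) ?scale1r//; ring.
Qed.

(** Passes from the form used by convexity to the increment form used by difference quotients. *)
Lemma segmentE (R : realType) (V : lmodType R) (t : R) (x y : V) :
  t *: y + (1 - t) *: x = t *: (y - x) + x.
Proof. by rewrite scalerBl scale1r scalerBr addrCA addrC. Qed.

Lemma cone_convex_diff_le (R : realType) (d : nat) (Y : normedModType R)
    (K : set Y) (H : 'rV[R]_d -> Y) (x y : 'rV[R]_d) :
  closed K -> convex_set K -> is_cone K -> cone_convex K H ->
  differentiable H x -> cone_le K (H x + 'd H x (y - x)) (H y).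
Proof.
move=> clK cK sK cH dH; rewrite /cone_le.
pose q (h : R) := h^-1 *: (H (h *: (y - x) + x) - H x).
have qK : \forall h \near (0 : R)^'+, K (H y - H x - q h).
  near=> h.
  have h0 : 0 < h by near: h; exact: nbhs_right_gt.
  have h1 : h <= 1 by near: h; exact: nbhs_right_le.
  have hI : 0 <= h <= 1 by rewrite ltW.
  (* Convexity with weight [h] on [y], scaled by [h^-1]; the bound [h <= 1] makes [h] an admissible
     weight. *)
  have := cH h y x hI; rewrite /cone_le => /(sK h^-1).
  rewrite invr_ge0 (ltW h0) => /(_ isT).
  rewrite !segmentE -addrA scalerDr scalerA mulVf ?gt_eqF// scale1r.
  by rewrite -[X in _ + _ *: X]opprB scalerN.
have qd : q h @[h --> (0 : R)^'+] --> 'd H x (y - x).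
  rewrite -deriveE//; apply: cvg_dnbhs_at_right.
  exact: (diff_derivable (v := y - x) dH).
rewrite opprD addrA; apply: (closed_cvg K clK qK).
exact: cvgB (cvg_cst _) qd.
Unshelve. all: by end_near. Qed.

Lemma dotvZr (R : realType) (d : nat) (t : R) (u v : 'rV[R]_d) :
  dotv u (t *: v) = t * dotv u v.
Proof.
by rewrite /dotv mulr_sumr; apply: eq_bigr => i _; rewrite mxE mulrCA.
Qed.

Theorem theorem4 (R : realType) (d : nat) (Y : completeNormedModType R)
    (K : set Y) (hK : proper_cone K)
    (g0 h0 : 'rV[R]_d -> R)
    (g0_convex : convex_function setT g0) (g0_closed : closed_function g0)
    (h0_convex : convex_function setT h0) (h0_closed : closed_function h0)
    (G H : 'rV[R]_d -> Y)
    (G_convex : cone_convex K G) (H_convex : cone_convex K H)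
    (Q : set 'rV[R]_d) (Q_closed : closed Q) (Q_convex : convex_set Q)
    (xs : 'rV[R]_d)
    (xs_opt : locally_optimal (fun x => g0 x - h0 x)
       [set x | cone_le K (G x - H x) 0 /\ Q x] xs)
    (H_diff : differentiable H xs)
    (v : 'rV[R]_d) (hv : subdifferential h0 xs v) :
  globally_optimal (fun x => g0 x - h0 xs - dotv v (x - xs))
    [set x | cone_le K (G x - H xs - 'd H xs (x - xs)) 0 /\ Q x] xs.
Proof.
case: hK => clK cK sK _; case: xs_opt => -[Fxs Qxs] xs_min.
have dot0 : dotv v (xs - xs) = 0.
  by rewrite subrr -(scale0r 0) dotvZr mul0r.
split=> [|y [Ly Qy]].
  by split=> //; rewrite subrr linear0 subr0.
pose z t : 'rV[R]_d := t *: (y - xs) + xs.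
have zB t : z t - xs = t *: (y - xs) by rewrite /z addrK.
have zQ t : 0 <= t -> t <= 1 -> Q (z t).
  move=> t0 t1; rewrite /z -segmentE; apply: set_mem.
  exact: (Q_convex y xs (Itv01 t0 t1) (mem_set Qy) (mem_set Qxs)).
have zF t : 0 <= t -> t <= 1 -> cone_le K (G (z t) - H (z t)) 0.
  move=> t0 t1; have tI : 0 <= t <= 1 by rewrite t0.
  have t'0 : 0 <= 1 - t by rewrite subr_ge0.
  have := G_convex t y xs tI; rewrite [t *: y + _]segmentE -/(z t).
  have := cone_convex_diff_le (z t) clK cK sK H_convex H_diff.
  rewrite zB linearZ/=.
  (* The constraints at [y] (linearized) and at [xs] (original), weighted by [t] and [1 - t], sum to
     [H xs + t *: 'd H xs (y - xs) - (t *: G y + (1 - t) *: G xs)] in [K]. Adding [Hz] replaces the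
     linearization by [H (z t)], and adding [Gz] replaces the combination of [G] values by
     [G (z t)]. *)
  move: Ly Fxs => /(sK t _ t0) Ly /(sK _ _ t'0) Fxs Hz Gz.
  have := convex_cone_add cK sK Ly Fxs; rewrite !sub0r.
  rewrite -[G y - _ - _]addrA -opprD !opprB scalerBr [in X in _ + X]scalerBr.
  rewrite addrACA -opprD scalerDr [t *: H xs + _]addrC.
  rewrite -[_ + _ + (1 - t) *: H xs]addrA.
  rewrite [t *: H xs + _]segmentE subrr scaler0 add0r [_ + H xs]addrC.
  move=> /(convex_cone_add cK sK Hz).
  rewrite addrA subrK => /(convex_cone_add cK sK)/(_ Gz).
  by rewrite /cone_le addrA subrK sub0r opprB.
have znear : \forall t \near (0 : R)^'+,
    g0 xs - h0 xs <= g0 (z t) - h0 (z t).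
  have zxs : z t @[t --> (0 : R)^'+] --> xs.
    apply: cvg_at_right_filter; rewrite -[X in _ --> X]add0r -(scale0r (y - xs)).
    by apply: cvgD; [apply: cvgZr_tmp; exact: cvg_id|exact: cvg_cst].
  have := zxs _ xs_min; rewrite !near_simpl => zmin.
  near=> t.
  have t0 : 0 <= t by apply/ltW; near: t; exact: nbhs_right_gt.
  have t1 : t <= 1 by near: t; exact: nbhs_right_le.
  have zS : cone_le K (G (z t) - H (z t)) 0 /\ Q (z t).
    by split; [exact: zF|exact: zQ].
  by move: zS; near: t.
(* One positive [t] suffices: no limit is taken in the objective. *)
have [t /and3P[t0 t1 zle]] : exists t : R,
    [&& 0 < t, t <= 1 & g0 xs - h0 xs <= g0 (z t) - h0 (z t)].
  apply: (@filter_ex _ (0 : R)^'+); near=> t; apply/and3P; split; near: t => //.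
  - exact: nbhs_right_gt.
  - exact: nbhs_right_le.
have g0z : g0 (z t) <= t * g0 y + (1 - t) * g0 xs.
  rewrite /z -segmentE.
  by apply: (g0_convex (Itv01 (ltW t0) t1) y xs); rewrite inE.
(* Chaining [zle], [g0z] and [h0z] bounds [t] times the desired difference of objectives below by 0,
   so the goal is multiplied by [t > 0]. *)
have := hv (z t); rewrite zB dotvZr dot0 => h0z.
rewrite subr0 -subr_ge0 -(pmulr_rge0 _ t0); nra.
Unshelve. all: by end_near. Qed.
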